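(* Let $G=(V,E)$ be a locally finite graph, and let $x,y\in V$ with $d(x,y)=\delta\ge 2$ (with $\delta$ a finite integer). Let $p^*\in(0,1)$ be a critical point of $\kappa_p(x,y)$. Then $$p^* \le \frac{1}{2}-\frac{1}{2}\cdot\frac{d_x+d_y}{2d_xd_y-d_x-d_y}.$$
   Context: Graphs have no multiple edges and no self loops. $d_v$ denotes the degree of the vertex $v$, $w\sim v$ means that $w$ and $v$ are adjacent, and $d(v,w)$ is the combinatorial distance (length of a shortest path). For $v\in V$ and $p\in[0,1]$, $\mu_v^p$ is the probability measure on $V$ with $\mu_v^p(v)=p$, $\mu_v^p(z)=\frac{1-p}{d_v}$ if $z\sim v$, and $\mu_v^p(z)=0$ otherwise. For probability measures $\mu_1,\mu_2$ on $V$, the Wasserstein distance is $W_1(\mu_1,\mu_2)=\inf_{\pi}\sum_{v\in V}\sum_{w\in V} d(v,w)\pi(v,w)$, the infimum over all $\pi:V\times V\to[0,1]$ with $\mu_1(v)=\sum_{w}\pi(v,w)$ and $\mu_2(w)=\sum_{v}\pi(v,w)$. The $p$-Ollivier-Ricci curvature is $\kappa_p(x,y)=1-\frac{W_1(\mu_x^p,\mu_y^p)}{d(x,y)}$. A critical point of $\kappa_p(x,y)$ is a value $p^*\in(0,1)$ such that $\lim_{p\to p^{*-}}\frac{\partial}{\partial p}\kappa_p(x,y)\ne\lim_{p\to p^{*+}}\frac{\partial}{\partial p}\kappa_p(x,y)$, i.e. a value of $p$ at which the slope of the piecewise linear function $p\mapsto\kappa_p(x,y)$ changes. *)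

(* Defs.v *)
From mathcomp Require Import all_boot all_order all_algebra.
From mathcomp Require Import finmap.
From mathcomp Require Import all_classical all_reals all_analysis.
Import Order.TTheory GRing.Theory Num.Theory.
Import numFieldNormedType.Exports.

Set Implicit Arguments.
Unset Strict Implicit.
Unset Printing Implicit Defensive.

Local Open Scope classical_set_scope.
Local Open Scope ring_scope.

Record graph (V : choiceType) := Graph {
  adj :> rel V;
  adj_sym : symmetric adj;
  adj_irrefl : irreflexive adj
}.

Section OllivierRicci.
Variables (R : realType) (V : choiceType) (G : graph V).
Implicit Types (v w x y z : V) (p : R) (mu : V -> R) (pi : V -> V -> R).

Definition neighbors v : set V := [set w | G v w].

Definition locally_finite := forall v, finite_set (neighbors v).

(* Junk value 0 when v has infinitely many neighbours. *)
Definition degree v : nat := #|` fset_set (neighbors v)|.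

(* The infimum is over the lengths of all walks from v to w; it is +oo when v
   and w lie in different connected components. *)
Definition dist v w : \bar R :=
  ereal_inf [set ((size s)%:R)%:E | s in [set s | path G v s /\ last v s = w]].

Definition idle_measure p v z : R :=
  if z == v then p else if G v z then (1 - p) / (degree v)%:R else 0.

Definition coupling mu1 mu2 : set (V -> V -> R) :=
  [set pi | [/\ forall v w, 0 <= pi v w <= 1,
                forall v, \esum_(w in [set: V]) (pi v w)%:E = (mu1 v)%:E &
                forall w, \esum_(v in [set: V]) (pi v w)%:E = (mu2 w)%:E]].

(* In \bar R, +oo * 0 = 0, so a pair of vertices in different components only
   contributes when it carries mass. *)
Definition transport_cost pi : \bar R :=
  \esum_(v in [set: V]) \esum_(w in [set: V]) (dist v w * (pi v w)%:E)%E.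

Definition W1 mu1 mu2 : \bar R :=
  ereal_inf [set transport_cost pi | pi in coupling mu1 mu2].

(* For x and y in the same component of a locally finite graph, and p in [0, 1],
   both the distance and W1 are finite, so that fine loses no information. *)
Definition kappa x y p : R :=
  1 - fine (W1 (idle_measure p x) (idle_measure p y)) / fine (dist x y).

End OllivierRicci.

Definition critical_point (R : realType) (f : R -> R) (p : R) : Prop :=
  0 < p < 1 /\
  exists l r : R,
    [/\ derive1 f q @[q --> p^'-] --> l,
        derive1 f q @[q --> p^'+] --> r & l <> r].

(* Main.v *)
(* Write W p for the Wasserstein distance between the measures of idleness p at x
   and y.  Mixing couplings shows that W is convex, and W 1 = d(x,y).  If p exceeds
   the bound, i.e. 1 - p < p + (1 - p)/d_x + (1 - p)/d_y, then any coupling can be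
   modified by a few exchanges (v -> w, v' -> w' becoming v -> w', v' -> w) along
   geodesics, never raising its cost, until it carries an amount e > 0 of mass
   from x to y, where e depends only on p, d_x and d_y.  Removing that mass and
   rescaling leaves a coupling of idleness p' = (p - e)/(1 - e), so that
   W p >= (1 - e) W p' + e d(x,y).  Thus W touches its chord over [p', 1] at the
   interior point p and, being convex, is affine on [p', 1]: p is not critical. *)
Require Import Defs.
From mathcomp Require Import all_boot all_order all_algebra finmap.
From mathcomp Require Import all_classical all_reals all_analysis.
From mathcomp Require Import lra ring.
Import Order.TTheory GRing.Theory Num.Theory.
Import numFieldNormedType.Exports.
Set Implicit Arguments.
Unset Strict Implicit.
Unset Printing Implicit Defensive.
Local Open Scope fset_scope.
Local Open Scope ring_scope.

(** * Finitely supported transport plans, their costs and operations on them *)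

Section TransportPlans.
Variable R : realFieldType.

(** The finite counterpart of [coupling]: vanishing off [A] and [B] makes all sums finite. The
    marginal equations are asked at every point, so [mu] vanishes off [A] and [nu] off [B]. *)
Record plan (I J : choiceType) (A : {fset I}) (B : {fset J})
    (mu : I -> R) (nu : J -> R) (pi : I -> J -> R) : Prop := Plan {
  plan_ge0 : forall i j, 0 <= pi i j;
  plan_suppl : forall i j, i \notin A -> pi i j = 0;
  plan_suppr : forall i j, j \notin B -> pi i j = 0;
  plan_row : forall i, \sum_(j <- B) pi i j = mu i;
  plan_col : forall j, \sum_(i <- A) pi i j = nu j }.

Definition cost (I J : choiceType) (A : {fset I}) (B : {fset J})
    (c : I -> J -> R) (pi : I -> J -> R) : R :=
  \sum_(i <- A) \sum_(j <- B) c i j * pi i j.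

Lemma plan_tr (I J : choiceType) (A : {fset I}) (B : {fset J}) mu nu pi :
  plan A B mu nu pi -> plan B A nu mu (fun j i => pi i j).
Proof. by case=> *; split; eauto. Qed.

Section Fixed.
Variables (I J : choiceType) (A : {fset I}) (B : {fset J}).
Implicit Types (mu : I -> R) (nu : J -> R) (pi c : I -> J -> R).

Lemma cost_lin c a b pi pi' :
  cost A B c (fun i j => a * pi i j + b * pi' i j) =
  a * cost A B c pi + b * cost A B c pi'.
Proof.
rewrite /cost !big_distrr -big_split /=; apply: eq_bigr => i _.
rewrite !big_distrr -big_split /=; apply: eq_bigr => j _; ring.
Qed.

Lemma plan_lin a b mu nu pi mu' nu' pi' : 0 <= a -> 0 <= b ->
  plan A B mu nu pi -> plan A B mu' nu' pi' ->
  plan A B (fun i => a * mu i + b * mu' i) (fun j => a * nu j + b * nu' j)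
    (fun i j => a * pi i j + b * pi' i j).
Proof.
move=> a0 b0 [p1 p2 p3 p4 p5] [q1 q2 q3 q4 q5]; split.
- by move=> i j; rewrite addr_ge0 ?mulr_ge0.
- by move=> i j iA; rewrite p2 ?q2 ?mulr0 ?addr0.
- by move=> i j iA; rewrite p3 ?q3 ?mulr0 ?addr0.
- by move=> i; rewrite big_split -!big_distrr /= p4 q4.
- by move=> i; rewrite big_split -!big_distrr /= p5 q5.
Qed.

Lemma sum_delta (K : choiceType) (S : {fset K}) (a : K) (F : K -> R) :
  a \in S -> \sum_(i <- S) (i == a)%:R * F i = F a.
Proof.
move=> aS; rewrite (big_fsetD1 a) //= eqxx mul1r big1_seq ?addr0 // => i.
by rewrite !inE => /andP[_ /andP[/negPf-> _]]; rewrite mul0r.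
Qed.

Lemma plan_delta (a : I) (b : J) : a \in A -> b \in B ->
  plan A B (fun i => (i == a)%:R) (fun j => (j == b)%:R)
    (fun i j => (i == a)%:R * (j == b)%:R).
Proof.
move=> aA bB; split.
- by move=> i j; rewrite mulr_ge0.
- by move=> i j; case: eqP => [->|_ _]; rewrite ?aA ?mul0r.
- by move=> i j; case: (j =P b) => [->|_ _]; rewrite ?bB ?mulr0.
- move=> i; under eq_bigr do rewrite mulrC.
  exact: (sum_delta (fun=> _)).
- by move=> j; rewrite (sum_delta (fun=> _)).
Qed.

Lemma cost_delta c (a : I) (b : J) : a \in A -> b \in B ->
  cost A B c (fun i j => (i == a)%:R * (j == b)%:R) = c a b.
Proof.
move=> aA bB; rewrite /cost -[RHS](sum_delta (c^~ b) aA).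
apply: eq_bigr => i _; rewrite -(sum_delta (c i) bB) big_distrr /=.
by apply: eq_bigr => j _; ring.
Qed.

Lemma plan_prod mu nu :
  (forall i, 0 <= mu i) -> (forall j, 0 <= nu j) ->
  (forall i, i \notin A -> mu i = 0) -> (forall j, j \notin B -> nu j = 0) ->
  \sum_(i <- A) mu i = 1 -> \sum_(j <- B) nu j = 1 ->
  plan A B mu nu (fun i j => mu i * nu j).
Proof.
move=> mu0 nu0 muA nuB mu1 nu1; split.
- by move=> i j; rewrite mulr_ge0.
- by move=> i j /muA ->; rewrite mul0r.
- by move=> i j /nuB ->; rewrite mulr0.
- by move=> i; rewrite -big_distrr /= nu1 mulr1.
- by move=> i; rewrite -big_distrl /= mu1 mul1r.
Qed.

Lemma plan_le_row mu nu pi i j : plan A B mu nu pi -> pi i j <= mu i.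
Proof.
move=> [p0 pA pB row _].
have [jB|jB] := boolP (j \in B); last by rewrite pB // -row sumr_ge0.
by rewrite -row (big_fsetD1 j) //= lerDl sumr_ge0.
Qed.

(** The entry at [(a, b)] stays nonnegative because it holds at least [e]; dividing by [1 - e]
    brings a total mass 1 back to 1. *)
Lemma plan_scale_sub e mu nu pi (a : I) (b : J) : a \in A -> b \in B ->
  0 < e < 1 -> plan A B mu nu pi -> e <= pi a b ->
  plan A B (fun i => (mu i - e * (i == a)%:R) / (1 - e))
    (fun j => (nu j - e * (j == b)%:R) / (1 - e))
    (fun i j => (pi i j - e * ((i == a)%:R * (j == b)%:R)) / (1 - e)).
Proof.
move=> aA bB /andP[e0 e1] [p1 p2 p3 p4 p5] epi.
have [d1 d2 d3 d4 d5] := plan_delta aA bB.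
split.
- move=> i j; rewrite divr_ge0 ?subr_ge0 ?(ltW e1) //.
  case: (i =P a) => [->|_]; last by rewrite mul0r mulr0.
  by case: (j =P b) => [->|_]; rewrite ?mulr0 // !mulr1.
- by move=> i j iA; rewrite p2 ?d2 // mulr0 subr0 mul0r.
- by move=> i j jB; rewrite p3 ?d3 // mulr0 subr0 mul0r.
- by move=> i; rewrite -mulr_suml sumrB -mulr_sumr p4 d4.
- by move=> j; rewrite -mulr_suml sumrB -mulr_sumr p5 d5.
Qed.

Lemma cost_scale_sub c e pi (a : I) (b : J) : a \in A -> b \in B ->
  cost A B c (fun i j => (pi i j - e * ((i == a)%:R * (j == b)%:R)) / (1 - e)) =
  (cost A B c pi - e * c a b) / (1 - e).
Proof.
move=> aA bB; transitivity (cost A B c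
    (fun i j => (1 - e)^-1 * pi i j +
                - (e / (1 - e)) * ((i == a)%:R * (j == b)%:R))).
  by apply: eq_bigr => i _; apply: eq_bigr => j _; ring.
by rewrite cost_lin cost_delta //; ring.
Qed.

(** An amount [t] of a -> u and of b -> v becomes a -> v and b -> u. The last clause lets mass
    already secured in a third row survive the exchange. *)
Lemma plan_exchange c mu nu pi (a b : I) (u v : J) t :
  plan A B mu nu pi -> a \in A -> b \in A -> u \in B -> v \in B ->
  a != b -> u != v -> 0 <= t -> t <= pi a u -> t <= pi b v ->
  c a v + c b u <= c a u + c b v ->
  exists pi', [/\ plan A B mu nu pi', cost A B c pi' <= cost A B c pi,
    t <= pi' a v & forall i j, i != a -> i != b -> pi' i j = pi i j].
Proof.
move=> [p0 pA pB row col] aA bA uB vB ab uv t0 ta tb cle.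
(* The perturbation [t * (s i * r j)] has rank one and both factors sum to 0, so the marginals do
   not change. *)
pose s (i : I) : R := (i == a)%:R - (i == b)%:R.
pose r (j : J) : R := (j == v)%:R - (j == u)%:R.
have sumD (K : choiceType) (S : {fset K}) (k l : K) (F : K -> R) :
    k \in S -> l \in S ->
    \sum_(i <- S) ((i == k)%:R - (i == l)%:R) * F i = F k - F l.
  move=> kS lS; under eq_bigr do rewrite mulrBl.
  by rewrite sumrB !sum_delta.
exists (fun i j => pi i j + t * (s i * r j)); split; first split.
(* Only the entries at [(a, u)] and [(b, v)] decrease, and each holds at least [t]. *)
- move=> i j; rewrite /s /r; have := p0 i j.
  have [->|ia] := eqVneq i a; rewrite ?(negPf ab).
    have [->|ju] := eqVneq j u; first by rewrite (negPf uv) /=; lra.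
    by case: (j == v) => /=; lra.
  have [->|ib] := eqVneq i b; last by rewrite subrr mul0r mulr0 addr0.
  have [->|jv] := eqVneq j v; first by rewrite [v == u]eq_sym (negPf uv) /=; lra.
  by case: (j == u) => /=; lra.
- move=> i j iA; rewrite pA // /s.
  case: (i =P a) => [ia|_]; first by rewrite ia aA in iA.
  case: (i =P b) => [ib|_]; first by rewrite ib bA in iA.
  by rewrite subr0 mul0r mulr0 addr0.
- move=> i j jB; rewrite pB // /r.
  case: (j =P v) => [jv|_]; first by rewrite jv vB in jB.
  case: (j =P u) => [ju|_]; first by rewrite ju uB in jB.
  by rewrite subr0 !mulr0 addr0.
- move=> i; rewrite big_split /= -!mulr_sumr row.
  under eq_bigr do rewrite -[r _]mulr1.
  by rewrite (sumD _ _ v u (fun=> 1)) // subrr !mulr0 addr0.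
- move=> j; rewrite big_split /= -!mulr_sumr -mulr_suml col.
  under eq_bigr do rewrite -[s _]mulr1.
  by rewrite (sumD _ _ a b (fun=> 1)) // subrr mul0r mulr0 addr0.
- rewrite [leLHS](_ : _ = cost A B c (fun i j => 1 * pi i j + t * (s i * r j))).
    rewrite cost_lin mul1r gerDl mulr_ge0_le0 //.
    have -> : cost A B c (fun i j => s i * r j) =
       (c a v - c a u) - (c b v - c b u).
      rewrite -(sumD _ _ a b (fun i => c i v - c i u) aA bA).
      apply: eq_bigr => i _; rewrite -(sumD _ _ v u (c i) vB uB) big_distrr /=.
      by apply: eq_bigr => j _; rewrite /s /r; ring.
    lra.
  by apply: eq_bigr => i _; apply: eq_bigr => j _; rewrite mul1r.
- rewrite /s /r !eqxx (negPf ab) [v == u]eq_sym (negPf uv) !subr0 !mulr1.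
  by rewrite lerDr.
- move=> i j /negPf ia /negPf ib; rewrite /s ia ib.
  by rewrite subr0 mul0r mulr0 addr0.
Qed.

(** Whatever rows [i] and [i'] send outside columns [j] and [j'] must fit into the total mass of the
    remaining columns. *)
Lemma plan_two_rows mu nu pi i i' j j' :
  plan A B mu nu pi -> i \in A -> i' \in A -> i != i' ->
  j \in B -> j' \in B -> j != j' ->
  mu i + mu i' <= pi i j + pi i j' + pi i' j + pi i' j' +
    \sum_(k <- B `\ j `\ j') nu k.
Proof.
move=> pl iA i'A ii' jB j'B jj'.
have j'Bj : j' \in B `\ j by rewrite !inE eq_sym jj'.
have i'Ai : i' \in A `\ i by rewrite !inE eq_sym ii'.
rewrite -!(plan_row pl) !(big_fsetD1 j jB) /= !(big_fsetD1 j' j'Bj) /=.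
have : \sum_(k <- B `\ j `\ j') (pi i k + pi i' k) <=
       \sum_(k <- B `\ j `\ j') nu k.
  apply: ler_sum => k _; rewrite -(plan_col pl) (big_fsetD1 i iA) /=.
  rewrite (big_fsetD1 i' i'Ai) /= addrA lerDl sumr_ge0 // => *.
  exact: (plan_ge0 pl).
rewrite big_split /=; lra.
Qed.

End Fixed.

Lemma exists_ge_avg (K : choiceType) (S : {fset K}) (F : K -> R) (e : R) :
  (#|` S|)%:R * e < \sum_(k <- S) F k -> exists2 k, k \in S & e <= F k.
Proof.
move=> lt; apply: contrapT => nex; move: lt; apply/negP; rewrite -leNgt.
have -> : (#|` S|)%:R * e = \sum_(k <- S) e.
  by rewrite big_const_seq count_predT iter_addr_0 mulr_natl.
rewrite [leLHS]big_seq [leRHS]big_seq; apply: ler_sum => k kS; rewrite leNgt.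
by apply/negP => /ltW ek; apply: nex; exists k.
Qed.


(** * Steering mass from x to y by exchanges *)

Section Concentration.
Variables (I J : choiceType) (x : I) (Nx : {fset I}) (y : J) (Ny : {fset J}).
Variables (c : I -> J -> R) (x1 : I) (y1 : J).
Hypotheses (xNx : x \notin Nx) (yNy : y \notin Ny).
Hypotheses (x1Nx : x1 \in Nx) (y1Ny : y1 \in Ny).
(** These inequalities encode geodesics: x, x1, ..., y1, y is one; in [c_first], [w] is the first
    step from [x] towards [z]; in [c_last], [z] is the last vertex before [y] on the way from
    [w]. *)
Hypothesis c_geod : c x y + c x1 y1 <= c x y1 + c x1 y.
Hypothesis c_first : forall z, z \in Ny ->
  exists2 w, w \in Nx & forall u, u \in y |` Ny -> c x u + c w z <= c x z + c w u.
Hypothesis c_last : forall w, w \in Nx ->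
  exists2 z, z \in Ny & forall a, a \in x |` Nx -> c a y + c w z <= c a z + c w y.

(* Exchanges along geodesics push mass from [x] to [y].  If none applied, the mass
   of two rows (or columns) would have to fit into the columns (rows) other than
   two given ones, which [m < p + al + be] forbids. *)
Lemma plan_steer (mu : I -> R) (nu : J -> R) (p m al be : R) :
  mu x = p -> nu y = p ->
  (forall w, w \in Nx -> mu w = al) -> (forall z, z \in Ny -> nu z = be) ->
  al * (#|` Nx|)%:R = m -> be * (#|` Ny|)%:R = m -> 0 < p -> m < p + al + be ->
  exists2 e, 0 < e < p & forall pi, plan (x |` Nx) (y |` Ny) mu nu pi ->
    exists pi', [/\ plan (x |` Nx) (y |` Ny) mu nu pi',
      cost (x |` Nx) (y |` Ny) c pi' <= cost (x |` Nx) (y |` Ny) c pi &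
      e <= pi' x y].
Proof.
set A := x |` Nx; set B := y |` Ny.
move=> mux nuy muN nuN alm bem p0 mlt.
pose dx : R := (#|` Nx|)%:R; pose dy : R := (#|` Ny|)%:R.
have dx0 : 0 <= dx by rewrite ler0n.
have dy0 : 0 <= dy by rewrite ler0n.
(* The 5 makes four entries below [e] too small to fill the slack [p + al + be - m]. The second
   bound ensures that a row or column of mass [p] with less than [e] at [(x, y)] has another entry
   of at least [e]. *)
pose e := Num.min ((p + al + be - m) / 5) (p / (dx + dy + 3)).
have e1 : 5 * e <= p + al + be - m.
  by rewrite mulrC -ler_pdivlMr // ge_min lexx.
have e2 : e * (dx + dy + 3) <= p.
  by rewrite -ler_pdivlMr ?ge_min ?lexx ?orbT //; lra.
have e0 : 0 < e.
  by rewrite lt_min; apply/andP; split; apply: divr_gt0; lra.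
have edx : dx * e + 2 * e < p.
  have : 0 <= e * dy by rewrite mulr_ge0 // ltW.
  by lra.
have edy : dy * e + 2 * e < p.
  have : 0 <= e * dx by rewrite mulr_ge0 // ltW.
  by lra.
have ep : e < p.
  have : 0 <= dx * e by rewrite mulr_ge0 // ltW.
  by lra.
have xA : x \in A by rewrite !inE eqxx.
have yB : y \in B by rewrite !inE eqxx.
have NxA w : w \in Nx -> w \in A by move=> wN; rewrite !inE wN orbT.
have NyB z : z \in Ny -> z \in B by move=> zN; rewrite !inE zN orbT.
have xN w : w \in Nx -> x != w by apply: contraTneq => <-.
have yN z : z \in Ny -> y != z by apply: contraTneq => <-.
have sumN (K : choiceType) (a k : K) (S : {fset K}) (F : K -> R) (f : R) :
    k \in S -> a \notin S -> (forall i, i \in S -> F i = f) ->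
    \sum_(i <- (a |` S) `\ a `\ k) F i = f * (#|` S|)%:R - f.
  move=> kS aS Ff; rewrite fsetU1K //.
  have -> : f * (#|` S|)%:R = \sum_(i <- S) F i.
    rewrite big_seq (eq_bigr (fun=> f)) // -big_seq.
    by rewrite big_const_seq count_predT iter_addr_0 mulr_natr.
  by rewrite (big_fsetD1 k kS) /= Ff // addrC addrK.
exists e => [|pi pl]; first by rewrite e0.
(* Second half of the steering: [x] already sends [e] to [y1], and mass entering [y] has to be found
   for a swap. *)
have caseA pi1 : plan A B mu nu pi1 -> e <= pi1 x y1 -> exists pi', [/\
    plan A B mu nu pi', cost A B c pi' <= cost A B c pi1 & e <= pi' x y].
  move=> pl1 exy1.
  have [?|xy] := leP e (pi1 x y); first by exists pi1.
  have fin pi2 : plan A B mu nu pi2 -> e <= pi2 x y1 -> e <= pi2 x1 y ->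
      exists pi', [/\ plan A B mu nu pi', cost A B c pi' <= cost A B c pi2 &
        e <= pi' x y].
    move=> pl2 h1 h2.
    have [|pi' [? ? ? _]] := plan_exchange pl2 xA (NxA _ x1Nx) (NyB _ y1Ny) yB
      (xN _ x1Nx) _ (ltW e0) h1 h2 c_geod; first by rewrite eq_sym yN.
    by exists pi'.
  have [x1y|x1y] := leP e (pi1 x1 y); first exact: fin.
  (* Column [y] has mass [p] and gets less than [e] from [x], so some neighbour [w] of [x] sends at
     least [e] to [y]. *)
  have [|w wN ew] := @exists_ge_avg _ Nx (pi1^~ y) e.
    have := plan_col pl1 y; rewrite nuy big_fsetU1 //= -/dx; lra.
  have [z zN wz] := c_last wN.
  have zy : z != y by rewrite eq_sym yN.
  have [xz|xz] := leP e (pi1 x z).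
    have [pi' [? ? ? _]] := plan_exchange pl1 xA (NxA _ wN) (NyB _ zN) yB
      (xN _ wN) zy (ltW e0) xz ew (wz _ xA).
    by exists pi'.
  have [x1z|x1z] := leP e (pi1 x1 z).
    have x1w : x1 != w.
      by apply/eqP => x1w; move: x1y; rewrite x1w ltNge ew.
    have [pi2 [pl2 c2 h2 h3]] := plan_exchange pl1 (NxA _ x1Nx) (NxA _ wN)
      (NyB _ zN) yB x1w zy (ltW e0) x1z ew (wz _ (NxA _ x1Nx)).
    (* Row [x] was not touched, so it still sends [e] to [y1], and now [x1] sends [e] to [y]. *)
    have [|pi' [? c' ?]] := fin _ pl2 _ h2; first by rewrite h3 // xN.
    by exists pi'; split => //; apply: le_trans c' c2.
  (* All four entries of rows [x], [x1] in columns [y], [z] are below [e], so these columns, of mass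
     [p + be], would have to be filled up to [4 * e] from the other rows, of mass [m - al]. *)
  have := plan_two_rows (plan_tr pl1) yB (NyB _ zN) (yN _ zN) xA
    (NxA _ x1Nx) (xN _ x1Nx).
  rewrite nuy nuN // (sumN _ _ _ _ _ al) // alm; lra.
have [?|xy] := leP e (pi x y); first by exists pi.
have [?|xy1] := leP e (pi x y1); first exact: caseA.
(* First half: row [x] sends at least [e] to some neighbour [z] of [y], and this is swapped against
   mass from the first step [w] into [y] or [y1]. *)
have [|z zN ez] := @exists_ge_avg _ Ny (pi x) e.
  have := plan_row pl x; rewrite mux big_fsetU1 //= -/dy; lra.
have [w wN wz] := c_first zN.
have zy : z != y by rewrite eq_sym yN.
have [wy|wy] := leP e (pi w y).
  have [pi' [? ? ? _]] := plan_exchange pl xA (NxA _ wN) (NyB _ zN) yB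
    (xN _ wN) zy (ltW e0) ez wy (wz _ yB).
  by exists pi'.
have [wy1|wy1] := leP e (pi w y1).
  have zy1 : z != y1.
    by apply/eqP => zy1; move: xy1; rewrite -zy1 ltNge ez.
  have [pi2 [pl2 c2 h2 _]] := plan_exchange pl xA (NxA _ wN) (NyB _ zN)
    (NyB _ y1Ny) (xN _ wN) zy1 (ltW e0) ez wy1 (wz _ (NyB _ y1Ny)).
  have [pi' [? c' ?]] := caseA _ pl2 h2.
  by exists pi'; split => //; apply: le_trans c' c2.
have := plan_two_rows pl xA (NxA _ wN) (xN _ wN) yB (NyB _ y1Ny) (yN _ y1Ny).
rewrite mux muN // (sumN _ _ _ _ _ be) // bem; lra.
Qed.

End Concentration.
End TransportPlans.

(** * Affine pieces of convex functions and critical points *)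

Section ConvexAffine.
Variable R : realType.
Implicit Types (f : R -> R) (p q a b s t : R).

Lemma affine_not_critical f a b s t p : a < p < b ->
  (forall q, a < q < b -> f q = s * q + t) -> ~ critical_point f p.
Proof.
move=> /andP[ap pb] fE [_ [l [r [fl fr]]]]; apply.
have D1 q : a < q < b -> derive1 f q = s.
  move=> /andP[aq qb]; rewrite derive1E.
  have -> : 'D_1 f q = 'D_1 (fun z : R => s * z + t) q.
    apply: near_eq_derive; near=> z; apply: fE; apply/andP; split; near: z.
      exact: lt_nbhsr.
    exact: lt_nbhsl.
  have H : is_derive q (1 : R) (fun z : R => s * z + t) (s *: 1 + 0).
    by apply: is_deriveD.
  by rewrite derive_val addr0 [LHS]mulr1.
have -> : l = s.
  apply: (cvg_unique _ fl) => //; apply: cvg_near_cst; near=> q; apply: D1.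
  apply/andP; split; near: q; first exact: nbhs_left_gt.
  apply: filterS (nbhs_left_lt p) => q /lt_trans; exact.
apply/esym/(cvg_unique _ fr) => //; apply: cvg_near_cst; near=> q; apply: D1.
apply/andP; split; near: q; last exact: nbhs_right_lt.
by apply: filterS (nbhs_right_gt p) => q; apply: lt_trans.
Unshelve. all: by end_near. Qed.

(** A value below the chord at [q] would pull the value at [p] below it as well, since [p] lies
    between [q] and one of the endpoints. *)
Lemma convex_affine f a b p : a < p < b ->
  (forall q q' s, a <= q <= b -> a <= q' <= b -> 0 <= s <= 1 ->
    f (s * q + (1 - s) * q') <= s * f q + (1 - s) * f q') ->
  (f b - f a) / (b - a) * (p - a) + f a <= f p ->
  forall q, a < q < b ->
  f q = (f b - f a) / (b - a) * q + (f a - (f b - f a) / (b - a) * a).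
Proof.
move=> /andP[ap pb] cvx; set k := (f b - f a) / (b - a) => fp q /andP[aq qb].
have ab : 0 < b - a by lra.
have fbE : f b = k * (b - a) + f a by rewrite /k divfK ?gt_eqF // subrK.
(* The three-point form of convexity with the denominator [w - u] cleared. *)
have conv u v w : a <= u -> u < v -> v < w -> w <= b ->
    f v * (w - u) <= f u * (w - v) + f w * (v - u).
  move=> au uv vw wb; have uw : 0 < w - u by lra.
  have /(_ _ _ _) := cvx u w ((w - v) / (w - u)).
  have s0 : 0 <= (w - v) / (w - u) by rewrite divr_ge0; lra.
  have s1 : (w - v) / (w - u) <= 1 by rewrite ler_pdivrMr //; lra.
  have -> : (w - v) / (w - u) * u + (1 - (w - v) / (w - u)) * w = v.
    by field; rewrite gt_eqF.
  rewrite s0 s1 => h; rewrite -ler_pdivlMr //; apply: le_trans (h _ _ _) _ => //.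
  - by apply/andP; split; lra.
  - by apply/andP; split; lra.
  by rewrite le_eqVlt; apply/orP; left; apply/eqP; field; rewrite gt_eqF.
apply/eqP; rewrite eq_le; apply/andP; split.
  have := conv a q b (lexx _) aq qb (lexx _); rewrite fbE => h.
  rewrite -(ler_pM2r ab); nra.
have [pq|qp|<-] := ltgtP p q; last by lra.
  have h := conv a p q (lexx _) ap pq (ltW qb).
  have pa : 0 < p - a by lra.
  rewrite -(ler_pM2r pa); nra.
have h := conv q p b (ltW aq) qp pb (lexx _).
have pa : 0 < b - p by lra.
by rewrite -(ler_pM2r pa); move: h; rewrite fbE; nra.
Qed.

End ConvexAffine.

(** * Finite distances and steps along geodesics *)

Section Geodesics.
Variables (R : realType) (V : choiceType) (G : graph V).
Implicit Types (u v w z : V) (s : seq V).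

Definition joined v w := exists s, path G v s /\ last v s = w.

(** [fine] sends +oo to 0, so this is the distance only between joined vertices. *)
Definition fdist v w : R := fine (dist R G v w).

Lemma joined_adj v w : G v w -> joined v w.
Proof. by move=> vw; exists [:: w]; rewrite /= vw. Qed.

Lemma joined_trans u v w : joined u v -> joined v w -> joined u w.
Proof.
move=> [s [ps <-]] [t [pt <-]]; exists (s ++ t).
by rewrite cat_path ps pt last_cat.
Qed.

(** Walk lengths are natural numbers, so the infimum is attained. *)
Lemma geodesic v w : joined v w -> exists s, [/\ path G v s, last v s = w &
  dist R G v w = (size s)%:R%:E].
Proof.
move=> vw; pose P n := `[< exists s, [/\ path G v s, last v s = w & size s = n] >].
have exP : exists n, P n.
  by case: vw => s [? ?]; exists (size s); apply/asboolP; exists s.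
case: (ex_minnP exP) => n /asboolP[s [ps ls sn]] nmin.
exists s; split => //; apply/eqP; rewrite eq_le; apply/andP; split.
  by apply: ereal_inf_lbound; exists s.
apply: le_ereal_inf_tmp => _ [t [pt lt] <-]; rewrite lee_fin ler_nat sn.
by apply: nmin; apply/asboolP; exists t.
Qed.

Lemma dist_fin v w : joined v w -> dist R G v w = (fdist v w)%:E.
Proof. by move=> /geodesic[s [_ _ ds]]; rewrite /fdist ds. Qed.

Lemma fdist_le s v w : path G v s -> last v s = w -> fdist v w <= (size s)%:R.
Proof.
move=> ps ls; rewrite -lee_fin -dist_fin; last by exists s.
by apply: ereal_inf_lbound; exists s.
Qed.

Lemma fdist_ge0 v w : 0 <= fdist v w.
Proof.
by rewrite fine_ge0 //; apply: le_ereal_inf_tmp => _ [s _ <-]; rewrite lee_fin.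
Qed.

Lemma fdist_triangle u v w : joined u v -> joined v w ->
  fdist u w <= fdist u v + fdist v w.
Proof.
move=> /geodesic[s [ps ls ds]] /geodesic[t [pt lt dt]].
rewrite {2 3}/fdist ds dt /= -natrD -size_cat; apply: fdist_le.
  by rewrite cat_path ps ls.
by rewrite last_cat ls.
Qed.

Lemma fdist_adj v w : G v w -> fdist v w <= 1.
Proof. by move=> vw; apply: (@fdist_le [:: w]); rewrite //= vw. Qed.

Lemma fdist_first_step v w : joined v w -> v != w ->
  exists u, [/\ G v u, joined u w & fdist u w <= fdist v w - 1].
Proof.
move=> /geodesic[[|u s] [/= ps ls ds]]; first by rewrite ls eqxx.
move: ps => /andP[vu ps] _; exists u; split => //; first by exists s.
by rewrite {2}/fdist ds /= -natr1 addrK; apply: fdist_le.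
Qed.

Lemma fdist_last_step v w : joined v w -> v != w ->
  exists u, [/\ G w u, joined v u & fdist v u <= fdist v w - 1].
Proof.
move=> /geodesic[s]; case/lastP: s => [|s u] [/= ps ls ds]; first by rewrite ls eqxx.
move: ps ls; rewrite rcons_path last_rcons => /andP[ps lu] uw _.
exists (last v s); split; first by rewrite adj_sym -uw.
  by exists s.
by rewrite {2}/fdist ds size_rcons -natr1 addrK; apply: fdist_le.
Qed.

End Geodesics.

(** * Couplings of finitely supported measures as finite plans *)

Section FinitelySupportedCouplings.
Variables (R : realType) (V : choiceType) (G : graph V) (A B : {fset V}).
Variables (mu nu : V -> R).
Hypothesis mu01 : forall v, 0 <= mu v <= 1.
Hypothesis muA : forall v, v \notin A -> mu v = 0.
Hypothesis nuB : forall v, v \notin B -> nu v = 0.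
Hypothesis AB : forall v w, v \in A -> w \in B -> joined G v w.

Lemma esum_fset_supp (S : {fset V}) (f : V -> \bar R) :
  (forall v, 0 <= f v)%E -> (forall v, v \notin S -> f v = 0%E) ->
  \esum_(v in [set: V]) f v = (\sum_(v <- S) f v)%E.
Proof.
move=> f0 fS; rewrite -[X in _ = X](_ : \esum_(v in [set` S]) f v = _).
  rewrite [RHS]esum_mkcond; apply: eq_esum => v _.
  by rewrite mem_setE; case: ifPn => // /fS.
by rewrite esum_fset // fsbig_finite //= set_fsetK.
Qed.

(** Each entry is bounded by both of its marginals, hence vanishes where one of them does, and the
    infinite sums collapse. *)
Lemma coupling_plan pi : coupling mu nu pi -> plan A B mu nu pi.
Proof.
move=> [pi01 row col].
have pi0 v w : 0 <= pi v w by case/andP: (pi01 v w).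
have le_esum1 (f : V -> R) v : (forall w, 0 <= f w) ->
    ((f v)%:E <= \esum_(w in [set: V]) (f w)%:E)%E.
  move=> f0; apply: esum_ge; exists [set v]%classic.
    by split; [exact: finite_set1|].
  by rewrite fsbig_set1.
have suppl v w : v \notin A -> pi v w = 0.
  move=> vA; apply/eqP; rewrite eq_le pi0 andbT -lee_fin -(muA vA) -row.
  exact: le_esum1.
have suppr v w : w \notin B -> pi v w = 0.
  move=> wB; apply/eqP; rewrite eq_le pi0 andbT -lee_fin -(nuB wB) -col.
  exact: (le_esum1 (pi^~ w)).
split => // [v|w]; apply: EFin_inj.
  rewrite -row -sumEFin; apply/esym; apply: esum_fset_supp => w.
    by rewrite lee_fin.
  by move=> /suppr ->.
rewrite -col -sumEFin; apply/esym; apply: esum_fset_supp => v.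
  by rewrite lee_fin.
by move=> /suppl ->.
Qed.

Lemma plan_coupling pi : plan A B mu nu pi -> coupling mu nu pi.
Proof.
move=> pl; have [pi0 suppl suppr row col] := pl; split.
- move=> v w; rewrite pi0 /=; apply: le_trans (plan_le_row v w pl) _.
  by case/andP: (mu01 v).
- move=> v; rewrite -row -sumEFin; apply: esum_fset_supp => w.
    by rewrite lee_fin.
  by move=> /suppr ->.
- move=> w; rewrite -col -sumEFin; apply: esum_fset_supp => v.
    by rewrite lee_fin.
  by move=> /suppl ->.
Qed.

(** Distances are finite on [A] times [B]; elsewhere [pi] is 0, and so is its product with a
    possibly infinite distance. *)
Lemma transport_costE pi : plan A B mu nu pi ->
  transport_cost G pi = (cost A B (fdist R G) pi)%:E.
Proof.
move=> [pi0 suppl suppr _ _].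
have t0 v w : (0 <= dist R G v w * (pi v w)%:E)%E.
  rewrite mule_ge0 ?lee_fin //.
  by apply: le_ereal_inf_tmp => _ [s _ <-]; rewrite lee_fin.
rewrite /transport_cost /cost -sumEFin (esum_fset_supp (S := A)).
- rewrite big_seq [RHS]big_seq; apply: eq_bigr => v vA.
  rewrite -sumEFin (esum_fset_supp (S := B)) //.
    rewrite big_seq [RHS]big_seq; apply: eq_bigr => w wB.
    by rewrite dist_fin ?EFinM //; apply: AB.
  by move=> w /suppr ->; rewrite mule0.
- by move=> v; apply: esum_ge0.
- by move=> v vA; apply: esum1 => w _; rewrite suppl // mule0.
Qed.

Lemma W1_fin pi : plan A B mu nu pi -> W1 G mu nu \is a fin_num.
Proof.
move=> pl; rewrite ge0_fin_numE; last first.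
  apply: le_ereal_inf_tmp => _ [pi' /coupling_plan pl' <-].
  rewrite transport_costE // lee_fin; apply: sumr_ge0 => v _.
  by apply: sumr_ge0 => w _; rewrite mulr_ge0 ?fdist_ge0 ?(plan_ge0 pl').
apply: le_lt_trans (ltry (cost A B (fdist R G) pi)).
by apply: ereal_inf_lbound; exists pi; rewrite ?transport_costE //; apply: plan_coupling.
Qed.

Lemma W1_le pi : plan A B mu nu pi ->
  fine (W1 G mu nu) <= cost A B (fdist R G) pi.
Proof.
move=> pl; rewrite -lee_fin fineK; last exact: W1_fin pl.
by apply: ereal_inf_lbound; exists pi; [exact: plan_coupling|exact: transport_costE].
Qed.

(** Near-optimal plans stand in for an optimal one; [pi0] witnesses that the infimum is finite. *)
Lemma W1_adherent pi0 e : plan A B mu nu pi0 -> 0 < e ->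
  exists2 pi, plan A B mu nu pi &
    cost A B (fdist R G) pi < fine (W1 G mu nu) + e.
Proof.
move=> pl e0; have [_ [pi /coupling_plan plpi <-]] :=
  lb_ereal_inf_adherent e0 (W1_fin pl).
rewrite transport_costE // -/(W1 G mu nu) -[W1 G mu nu]fineK ?(W1_fin pl) //.
by rewrite -EFinD lte_fin => lt; exists pi.
Qed.

End FinitelySupportedCouplings.

(** * The idle measures as a family in the idleness p *)

Section IdleMeasure.
Variables (R : realType) (V : choiceType) (G : graph V).
Hypothesis Glf : locally_finite G.
Implicit Types (p q s e : R) (v z : V).

Let N v : {fset V} := fset_set (neighbors G v).

Lemma in_neighbors v z : (z \in fset_set (neighbors G v)) = G v z.
Proof. by rewrite in_fset_set ?mem_setE //; apply: Glf. Qed.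

Lemma notin_neighbors v : v \notin N v.
Proof. by rewrite in_neighbors adj_irrefl. Qed.

Lemma idle_measure_self p v : idle_measure G p v v = p.
Proof. by rewrite /idle_measure eqxx. Qed.

Lemma idle_measure_adj p v z : z \in N v ->
  idle_measure G p v z = (1 - p) / (degree G v)%:R.
Proof.
rewrite in_neighbors /idle_measure => vz; rewrite vz ifN //.
by apply: contraTneq vz => ->; rewrite adj_irrefl.
Qed.

Lemma idle_measure_supp p v z : z \notin v |` N v -> idle_measure G p v z = 0.
Proof.
by rewrite !inE in_neighbors /idle_measure => /norP[/negPf -> /negPf ->].
Qed.

Lemma idle_measure_01 p v z : 0 <= p <= 1 -> 0 <= idle_measure G p v z <= 1.
Proof.
move=> /andP[p0 p1]; rewrite /idle_measure; case: eqP => _; first by rewrite p0.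
case: ifPn => [vz|_]; last by rewrite lexx ler01.
have d1 : 1 <= (degree G v)%:R :> R.
  rewrite ler1n lt0n cardfs_eq0; apply/eqP => N0.
  by have := in_neighbors v z; rewrite N0 vz inE.
have d0 := lt_le_trans ltr01 d1.
by rewrite divr_ge0 ?subr_ge0 ?(ltW d0) //= ler_pdivrMr //; lra.
Qed.

Lemma idle_measure_sum p v : N v != fset0 ->
  \sum_(z <- v |` N v) idle_measure G p v z = 1.
Proof.
move=> Nv; rewrite big_fsetU1 ?notin_neighbors //= idle_measure_self.
rewrite big_seq (eq_bigr _ (fun z => @idle_measure_adj p v z)) -big_seq.
rewrite big_const_seq count_predT iter_addr_0 -(mulr_natr (_ / _)) divfK.
  by rewrite addrC subrK.
by rewrite pnatr_eq0 cardfs_eq0.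
Qed.

(** Affinity in the idleness makes a mixture of plans a plan for the mixed idleness, whence
    convexity of W. *)
Lemma idle_measure_lin s p q v z :
  idle_measure G (s * p + (1 - s) * q) v z =
  s * idle_measure G p v z + (1 - s) * idle_measure G q v z.
Proof. by rewrite /idle_measure; case: eqP => // _; case: ifP => _; ring. Qed.

Lemma idle_measure1 v z : idle_measure G 1 v z = (z == v)%:R :> R.
Proof.
by rewrite /idle_measure; case: eqP => // _; rewrite subrr mul0r if_same.
Qed.

(** The family is stable under removing mass at the centre and rescaling, because [1 - (p - e) / (1
    - e) = (1 - p) / (1 - e)]. *)
Lemma idle_measure_scale_sub e p v z : e < 1 ->
  (idle_measure G p v z - e * (z == v)%:R) / (1 - e) =
  idle_measure G ((p - e) / (1 - e)) v z.
Proof.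
move=> e1; have e0 : 1 - e != 0 by rewrite subr_eq0 gt_eqF.
rewrite /idle_measure; case: eqP => _; first by rewrite mulr1.
case: ifP => _; last by rewrite mulr0 subr0 mul0r.
rewrite mulr0 subr0 mulrAC; congr (_ / _).
by field.
Qed.

End IdleMeasure.

(** * Affinity of W near a large idleness *)

Section LargeIdleness.
Variables (R : realType) (V : choiceType) (G : graph V).
Hypothesis Glf : locally_finite G.
Variables (x y : V) (delta : nat).
Hypotheses (hdelta : (2 <= delta)%N) (hdist : dist R G x y = (delta%:R)%:E).
Implicit Types (p q s : R).

Let Nx := fset_set (neighbors G x).
Let Ny := fset_set (neighbors G y).
Let A := x |` Nx.
Let B := y |` Ny.
Let W p := fine (W1 G (idle_measure G p x) (idle_measure G p y)).
Let idle_plan p := plan A B (idle_measure G p x) (idle_measure G p y).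
Let idle_cost := cost A B (fdist R G).

Let delta2 : 2 <= delta%:R :> R. Proof. by rewrite ler_nat. Qed.

Let fdist_xy : fdist R G x y = delta%:R.
Proof. by rewrite /fdist hdist. Qed.

Let joined_xy : joined G x y.
Proof.
apply: contrapT => nxy.
suff : dist R G x y = +oo%E by rewrite hdist.
by apply/ereal_inf_pinfty => t [s sxy _]; case: nxy; exists s.
Qed.

Let joined_AB v w : v \in A -> w \in B -> joined G v w.
Proof.
have refl u : joined G u u by exists [::].
rewrite !inE !in_neighbors // => vA wB.
apply: (@joined_trans _ _ _ x).
  case/orP: vA => [/eqP->//|xv]; apply: joined_adj; by rewrite adj_sym.
apply: joined_trans joined_xy _.
by case/orP: wB => [/eqP->//|yw]; apply: joined_adj.
Qed.

Let fdist_gt0_neq v w : 0 < fdist R G v w -> v != w.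
Proof.
apply: contraTneq => <-; rewrite -leNgt.
exact: (@fdist_le _ _ _ [::]).
Qed.

(** The left side is at most [2 * delta - 2], and the right side at least that by the triangle
    inequality. As [delta >= 2], [x1] differs from [y], so a last step from [x1] to [y] exists. *)
Let geodesic_ends : exists x1 y1, [/\ x1 \in Nx, y1 \in Ny &
  fdist R G x y + fdist R G x1 y1 <= fdist R G x y1 + fdist R G x1 y].
Proof.
have [|x1 [xx1 x1y d1]] := fdist_first_step R joined_xy.
  by apply: fdist_gt0_neq; rewrite fdist_xy; have := delta2; lra.
have t1 := fdist_triangle R (joined_adj xx1) x1y.
have xyE := fdist_xy; have d2 := delta2.
have a1 := fdist_adj R xx1.
have [|y1 [yy1 x1y1 d3]] := fdist_last_step R x1y.
  by apply: fdist_gt0_neq; lra.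
have y1y : G y1 y by rewrite adj_sym.
have xy1 := joined_trans (joined_adj xx1) x1y1.
have t2 := fdist_triangle R xy1 (joined_adj y1y).
have a2 := fdist_adj R y1y.
by exists x1, y1; rewrite !in_neighbors //; split=> //; lra.
Qed.

(** [w] is one step closer to [z] than [x] is, while moving from [x] to [w] shortens the way to [u]
    by at most 1. As [delta >= 2], [z] is not [x]. *)
Let first_step z : z \in Ny -> exists2 w, w \in Nx & forall u, u \in B ->
  fdist R G x u + fdist R G w z <= fdist R G x z + fdist R G w u.
Proof.
rewrite in_neighbors // => yz.
have xz := joined_trans joined_xy (joined_adj yz).
have zy : G z y by rewrite adj_sym.
have [|w [xw wz d]] := fdist_first_step R xz.
  apply: fdist_gt0_neq; have := fdist_triangle R xz (joined_adj zy).
  by have := fdist_adj R zy; have := fdist_xy; have := delta2; lra.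
exists w; rewrite ?in_neighbors // => u uB.
have wu : joined G w u by apply: joined_AB uB; rewrite !inE in_neighbors // xw orbT.
have := fdist_triangle R (joined_adj xw) wu; have := fdist_adj R xw; lra.
Qed.

Let last_step w : w \in Nx -> exists2 z, z \in Ny & forall a, a \in A ->
  fdist R G a y + fdist R G w z <= fdist R G a z + fdist R G w y.
Proof.
rewrite in_neighbors // => xw.
have wy : joined G w y.
  by apply: joined_trans joined_xy; apply: joined_adj; rewrite adj_sym.
have [|z [yz wz d]] := fdist_last_step R wy.
  apply: fdist_gt0_neq; have := fdist_triangle R (joined_adj xw) wy.
  by have := fdist_adj R xw; have := fdist_xy; have := delta2; lra.
exists z; rewrite ?in_neighbors // => a aA.
have zy : G z y by rewrite adj_sym.
have az : joined G a z by apply: joined_AB => //; rewrite !inE in_neighbors // yz orbT.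
have := fdist_triangle R az (joined_adj zy); have := fdist_adj R zy; lra.
Qed.

Let idle_plan_ex p : 0 <= p <= 1 -> exists pi, idle_plan p pi.
Proof.
have [x1 [y1 [x1N y1N _]]] := geodesic_ends.
move=> p01; eexists; apply: plan_prod.
- by move=> i; case/andP: (idle_measure_01 Glf x i p01).
- by move=> i; case/andP: (idle_measure_01 Glf y i p01).
- by move=> i; apply: idle_measure_supp.
- by move=> i; apply: idle_measure_supp.
- by apply: idle_measure_sum => //; apply/fset0Pn; exists x1.
- by apply: idle_measure_sum => //; apply/fset0Pn; exists y1.
Qed.

Let W_le p pi : 0 <= p <= 1 -> idle_plan p pi -> W p <= idle_cost pi.
Proof.
move=> p01; apply: W1_le; [|exact: idle_measure_supp..|exact: joined_AB].
by move=> v; apply: idle_measure_01.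
Qed.

Let W_adherent p e : 0 <= p <= 1 -> 0 < e ->
  exists2 pi, idle_plan p pi & idle_cost pi < W p + e.
Proof.
move=> p01; have [pi pl] := idle_plan_ex p01; apply: W1_adherent pl;
  [|exact: idle_measure_supp..|exact: joined_AB].
by move=> v; apply: idle_measure_01.
Qed.

Let W_convex q q' s : 0 <= q <= 1 -> 0 <= q' <= 1 -> 0 <= s <= 1 ->
  W (s * q + (1 - s) * q') <= s * W q + (1 - s) * W q'.
Proof.
move=> q01 q'01 s01; apply/ler_addgt0Pr => e e0.
have [pi pl lt] := W_adherent q01 e0.
have [pi' pl' lt'] := W_adherent q'01 e0.
have [s0 s1] : 0 <= s /\ 0 <= 1 - s by case/andP: s01 => *; lra.
have /W_le : idle_plan (s * q + (1 - s) * q')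
    (fun i j => s * pi i j + (1 - s) * pi' i j).
  have := plan_lin s0 s1 pl pl'.
  by under eq_fun do rewrite -idle_measure_lin;
     under [X in plan _ _ _ X]eq_fun do rewrite -idle_measure_lin.
rewrite /idle_cost cost_lin -!/(idle_cost _) => /(_ _)/le_trans; apply.
  case/andP: q01 => *; case/andP: q'01 => *; apply/andP; split; nra.
nra.
Qed.

Let W1_le_delta : W 1 <= delta%:R.
Proof.
rewrite -fdist_xy -(@cost_delta _ _ _ A B _ x y) ?inE ?eqxx //.
apply: W_le; first by rewrite ler01 lexx.
have := @plan_delta R _ _ A B x y; rewrite !inE !eqxx => /(_ isT isT).
by under eq_fun do rewrite -(idle_measure1 R G);
   under [X in plan _ _ _ X]eq_fun do rewrite -(idle_measure1 R G).
Qed.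

Let W_chord p : 0 < p < 1 ->
  1 - p < p + (1 - p) / (degree G x)%:R + (1 - p) / (degree G y)%:R ->
  exists2 e, 0 < e < p & (1 - e) * W ((p - e) / (1 - e)) + e * delta%:R <= W p.
Proof.
move=> /andP[p0 p1] hp.
have [x1 [y1 [x1N y1N geod]]] := geodesic_ends.
have d0 v w : w \in fset_set (neighbors G v) -> (degree G v)%:R != 0 :> R.
  by rewrite pnatr_eq0 cardfs_eq0 => wN; apply/fset0Pn; exists w.
have [e /andP[e0 ep] steer] := plan_steer (notin_neighbors Glf x)
  (notin_neighbors Glf y) x1N y1N geod first_step last_step
  (idle_measure_self G p x) (idle_measure_self G p y)
  (idle_measure_adj Glf p (v := x)) (idle_measure_adj Glf p (v := y))
  (divfK (d0 _ _ x1N) _) (divfK (d0 _ _ y1N) _) p0 hp.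
have e1 : e < 1 by apply: lt_trans p1.
exists e; first by rewrite e0.
(* [e] was fixed before any plan, so the error [t] of a near-optimal plan can tend to 0 while [e]
   stays. *)
apply/ler_addgt0Pr => t t0.
have [|pi /steer[pi' [pl' c' epi']] lt] := @W_adherent p t _ t0.
  by rewrite !ltW.
apply: le_trans (ltW lt); apply: le_trans c'.
have xA : x \in A by rewrite !inE eqxx.
have yB : y \in B by rewrite !inE eqxx.
have := @plan_scale_sub _ _ _ _ _ e _ _ _ x y xA yB _ pl' epi'.
rewrite e0 e1 => /(_ isT).
under eq_fun do rewrite idle_measure_scale_sub //.
under [X in plan _ _ _ X]eq_fun do rewrite idle_measure_scale_sub //.
move=> /W_le; rewrite /idle_cost cost_scale_sub // fdist_xy.
have e'0 : 0 < 1 - e by lra.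
move=> h; rewrite -lerBrDr mulrC -ler_pdivlMr //; apply: h.
by rewrite divr_ge0 ?ler_pdivrMr //; lra.
Qed.

Lemma large_idleness_not_critical p : 0 < p < 1 ->
  1 - p < p + (1 - p) / (degree G x)%:R + (1 - p) / (degree G y)%:R ->
  ~ critical_point (kappa G x y) p.
Proof.
move=> p01 hp; have [e /andP[e0 ep] chord] := W_chord p01 hp.
case/andP: p01 => p0 p1.
have e1 : 0 < 1 - e by lra.
move: chord; set a := (p - e) / (1 - e) => chord.
have aE : a * (1 - e) = p - e by rewrite divfK // gt_eqF.
have a0 : 0 <= a by rewrite divr_ge0; lra.
have ap : a < p by rewrite ltr_pdivrMr //; nra.
have ap1 : a < p < 1 by rewrite ap.
have := @convex_affine R W a 1 p ap1.
set k := (W 1 - W a) / (1 - a) => affine.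
have WE q : a < q < 1 -> W q = k * q + (W a - k * a).
  apply: affine => [u v s /andP[? ?] /andP[? ?] s01|].
    by apply: W_convex => //; apply/andP; split; lra.
  (* Since [p = (1 - e) * a + e], the chord over [[a, 1]] has value [(1 - e) * W a + e * W 1] at
     [p], which [W 1 <= delta] and [chord] bound by [W p]. *)
  have -> : p - a = e * (1 - a) by lra.
  have -> : k * (e * (1 - a)) = e * (W 1 - W a).
    by rewrite /k; field; rewrite gt_eqF //; lra.
  have := ler_wpM2l (ltW e0) W1_le_delta; lra.
apply: (@affine_not_critical R _ a 1 (- (k / delta%:R))
  (1 - (W a - k * a) / delta%:R)) => // q /WE Wq.
by rewrite /kappa -/(W q) Wq -/(fdist R G x y) fdist_xy; ring.
Qed.

Lemma degree_ge1 : (1 <= degree G x)%N /\ (1 <= degree G y)%N.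
Proof.
have [x1 [y1 [x1N y1N _]]] := geodesic_ends.
by rewrite !lt0n !cardfs_eq0; split; apply/fset0Pn; [exists x1|exists y1].
Qed.

End LargeIdleness.

(** * From the mass condition to the bound in the degrees *)

Theorem theorem4p1 (R : realType) (V : choiceType) (G : graph V)
    (Glf : locally_finite G) (x y : V) (delta : nat)
    (hdelta : (2 <= delta)%N) (hdist : dist R G x y = (delta%:R)%:E)
    (pstar : R) (hp : critical_point (kappa G x y) pstar) :
  let dx : R := (degree G x)%:R in
  let dy : R := (degree G y)%:R in
  pstar <= 1 / 2 - 1 / 2 * ((dx + dy) / (2 * dx * dy - dx - dy)).
Proof.
cbv zeta; set dx := (degree G x)%:R; set dy := (degree G y)%:R.
rewrite leNgt; apply/negP => bnd.
have [p01 _] := hp.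
apply: (large_idleness_not_critical Glf hdelta hdist p01) hp.
have [] := degree_ge1 Glf hdelta hdist.
rewrite -(ler_nat R) -/dx => dx1; rewrite -(ler_nat R) -/dy => dy1.
rewrite -/dx -/dy.
have dx0 : 0 < dx by apply: lt_le_trans dx1.
have dy0 : 0 < dy by apply: lt_le_trans dy1.
case/andP: p01 => p0 p1.
(* The denominator vanishes only for [dx = dy = 1]; division by 0 gives 0, so the bound then reads
   1/2, and [pstar > 1/2] already yields the mass condition. *)
have [D0|D0] := eqVneq (2 * dx * dy - dx - dy) 0.
  move: bnd; rewrite D0 invr0 !mulr0 subr0 => bnd.
  have : 0 < (1 - pstar) / dx by rewrite divr_gt0 // subr_gt0.
  have : 0 < (1 - pstar) / dy by rewrite divr_gt0 // subr_gt0.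
  lra.
have D1 : 0 < 2 * dx * dy - dx - dy by rewrite lt_def D0 /=; nra.
(* The bound equals [(dx * dy - dx - dy) / (2 * dx * dy - dx - dy)]. *)
have {}bnd : dx * dy - dx - dy < pstar * (2 * dx * dy - dx - dy).
  rewrite -ltr_pdivrMr //; apply: le_lt_trans bnd.
  by rewrite le_eqVlt; apply/orP; left; apply/eqP; field.
rewrite -subr_gt0.
have -> : pstar + (1 - pstar) / dx + (1 - pstar) / dy - (1 - pstar) =
    (pstar * (2 * dx * dy - dx - dy) - (dx * dy - dx - dy)) / (dx * dy).
  by field; rewrite !gt_eqF.
by rewrite divr_gt0 ?mulr_gt0 // subr_gt0.
Qed.
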